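(* There is an algorithm which, given a finite subset $X$ of Thompson's group $F$, decides whether the finitely generated subgroup $H=\langle X\rangle$ acts transitively on the set of finite dyadic fractions $\mathcal D=\mathbb{Z}[\frac12]\cap(0,1)$.
   Context: Thompson's group $F$ is the group of all piecewise-linear increasing homeomorphisms of $[0,1]$ with finitely many breakpoints, all of which are in $\mathbb{Z}[\frac12]\cap(0,1)$, and with all slopes integer powers of $2$. It is generated by two elements $x_0,x_1$: $x_0$ equals $2t$ on $[0,\frac14]$, $t+\frac14$ on $[\frac14,\frac12]$, $\frac t2+\frac12$ on $[\frac12,1]$; $x_1$ equals $t$ on $[0,\frac12]$, $2t-\frac12$ on $[\frac12,\frac58]$, $t+\frac18$ on $[\frac58,\frac34]$, $\frac t2+\frac12$ on $[\frac34,1]$. Elements of $F$ are given to the algorithm in any standard effective form (for instance as words in $x_0^{\pm1},x_1^{\pm1}$, or as lists of breakpoints and their images). *)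

(* Defs.v *)
From HB Require Import structures.
From mathcomp Require Import all_boot all_order all_algebra.
From mathcomp Require Import all_classical all_reals all_analysis.
From mathcomp Require Import ring lra.

Set Implicit Arguments.
Unset Strict Implicit.
Unset Printing Implicit Defensive.

Import Order.TTheory GRing.Theory Num.Theory.
Import numFieldNormedType.Exports.

Local Open Scope classical_set_scope.
Local Open Scope ring_scope.

(** * Recursive functions *)

(* The total recursive functions: the smallest class of functions
   nat^n -> nat containing the zero functions, the successor and the
   projections, and closed under composition, primitive recursion and
   minimization of regular functions.  Every clause describes the new function
   by its values, so that the class is closed under extensional equality.  In
   [rec_min], the hypothesis says that [f v] is the least zero of
   [k |-> g (k, v)]; as [f] is total, it entails that such a zero exists for
   every [v]. *)
Inductive recursive : forall n : nat, (n.-tuple nat -> nat) -> Prop :=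
| rec_zero n (f : n.-tuple nat -> nat) :
    (forall v, f v = 0%N) -> recursive f
| rec_succ (f : 1.-tuple nat -> nat) :
    (forall v, f v = (tnth v ord0).+1) -> recursive f
| rec_proj n (i : 'I_n) (f : n.-tuple nat -> nat) :
    (forall v, f v = tnth v i) -> recursive f
| rec_comp m n (g : m.-tuple nat -> nat) (h : 'I_m -> n.-tuple nat -> nat)
    (f : n.-tuple nat -> nat) :
    recursive g -> (forall i, recursive (h i)) ->
    (forall v, f v = g [tuple h i v | i < m]) -> recursive f
| rec_prim n (g : n.-tuple nat -> nat) (h : n.+2.-tuple nat -> nat)
    (f : n.+1.-tuple nat -> nat) :
    recursive g -> recursive h ->
    (forall v : n.-tuple nat, f [tuple of 0%N :: v] = g v) ->
    (forall (k : nat) (v : n.-tuple nat),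
       f [tuple of k.+1 :: v] = h [tuple of k :: f [tuple of k :: v] :: v]) ->
    recursive f
| rec_min n (g : n.+1.-tuple nat -> nat) (f : n.-tuple nat -> nat) :
    recursive g ->
    (forall v : n.-tuple nat, g [tuple of f v :: v] = 0%N /\
       forall k : nat, (k < f v)%N -> g [tuple of k :: v] <> 0%N) ->
    recursive f.

(* The problem [P] on inputs from [T], presented to the algorithm through
   their codes, has a recursive characteristic function. *)
Definition algorithmically_decidable (T : Type) (code : T -> nat)
    (P : T -> Prop) : Prop :=
  exists2 chi : 1.-tuple nat -> nat, recursive chi &
    forall x : T, (P x -> chi [tuple code x] = 1%N) /\
                  (~ P x -> chi [tuple code x] = 0%N).

(** * Thompson's group F *)

Definition dyadic (R : realType) (x : R) : Prop :=
  exists (m : int) (n : nat), x = m%:~R / 2 ^+ n.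

(* The set Z[1/2] \cap (0, 1). *)
Definition dyadic_fractions (R : realType) : set R :=
  [set x | dyadic x /\ 0 < x < 1].
Arguments dyadic_fractions : clear implicits.

(* Self-maps of [0, 1] are represented by maps R -> R that are the identity
   outside [0, 1], so that Leibniz equality of functions is equality of
   self-maps of [0, 1].  An increasing continuous bijection of the compact
   interval [0, 1] is a homeomorphism.  The points of [s] are the allowed
   breakpoints: [f] is affine, with slope a power of 2, on every subinterval
   whose interior contains no point of [s]. *)
Record is_thompson (R : realType) (f : R -> R) : Prop := IsThompson {
  thompson_out : forall t : R, ~~ (0 <= t <= 1) -> f t = t;
  thompson_bij : set_bij `[0, 1] `[0, 1] f;
  thompson_incr : {in `[0, 1] &, {homo f : x y / x < y}};
  thompson_cont : {within `[0, 1], continuous f};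
  thompson_pl : exists2 s : seq R,
    (forall p : R, p \in s -> dyadic_fractions R p) &
    forall a b : R, 0 <= a -> a < b -> b <= 1 ->
      (forall p : R, p \in s -> ~~ (a < p < b)) ->
      exists (k : int) (c : R), forall t : R, a <= t <= b -> f t = 2 ^ k * t + c
}.

Record thompsonF (R : realType) := ThompsonF {
  thompson_fun :> R -> R;
  thompson_funP : `[< is_thompson thompson_fun >]
}.

Section ThompsonFacts.
Variable R : realType.
Implicit Types (f g : R -> R) (x y t : R).

Lemma dyadic0 : dyadic (0 : R).
Proof. by exists 0, 0%N; rewrite mul0r. Qed.

Lemma dyadicN x : dyadic x -> dyadic (- x).
Proof. by move=> [m [n ->]]; exists (- m), n; rewrite mulrNz mulNr. Qed.

Lemma dyadicD x y : dyadic x -> dyadic y -> dyadic (x + y).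
Proof.
move=> [m [n ->]] [m' [n' ->]].
exists (m * 2 ^+ n' + m' * 2 ^+ n), (n + n')%N.
rewrite rmorphD !rmorphM !rmorphXn /= exprD.
by field; rewrite !expf_neq0 ?pnatr_eq0.
Qed.

Lemma dyadic_scale (k : int) x : dyadic x -> dyadic (2 ^ k * x).
Proof.
move=> [m [n ->]]; case: k => k.
  by exists (m * 2 ^+ k), n; rewrite rmorphM rmorphXn /= mulrA [_ * m%:~R]mulrC.
exists m, (n + k.+1)%N; rewrite NegzE -exprnN exprD.
by field; rewrite !expf_neq0 ?pnatr_eq0.
Qed.

(* The greatest point of [s] below [d], or 0. *)
Lemma last_breakpoint (s : seq R) (d : R) : 0 < d ->
  exists p : R, [/\ 0 <= p < d, p = 0 \/ p \in s &
                forall q, q \in s -> ~~ (p < q < d)].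
Proof.
move=> d0; elim: s => [|q s [p [pd ps pmax]]].
  by exists 0; split; rewrite ?lexx //; left.
case: (boolP (p < q < d)) => pqd.
  exists q; split; [lra | by right; rewrite mem_head |] => r.
  rewrite inE => /orP[/eqP->|/pmax]; first by rewrite ltxx.
  by apply: contra => ?; lra.
exists p; split=> //.
  by case: ps => ps; [left|right; rewrite inE ps orbT].
by move=> r; rewrite inE => /orP[/eqP->|/pmax].
Qed.

Lemma thompson_mono f : is_thompson f ->
  {in `[0, 1] &, {mono f : x y / x <= y}}.
Proof. by move=> /thompson_incr hf; exact: le_mono_in. Qed.

Lemma thompson_itv f x : is_thompson f -> 0 <= x <= 1 -> 0 <= f x <= 1.
Proof.
move=> hf x01; have [h _ _] := thompson_bij hf.
by have := h x; rewrite /= !in_itv /=; apply.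
Qed.

Lemma thompson0 f : is_thompson f -> f 0 = 0.
Proof.
move=> hf; have [_ _ h] := thompson_bij hf.
have [|x] := h 0; first by rewrite /= in_itv /= lexx ler01.
rewrite /= in_itv /= => x01 fx0.
have /andP[f0 _] := thompson_itv hf (x := 0) ltac:(lra).
apply/eqP; rewrite eq_le f0 andbT -[leRHS]fx0 (thompson_mono hf) ?in_itv /=; lra.
Qed.

Lemma thompson1 f : is_thompson f -> f 1 = 1.
Proof.
move=> hf; have [_ _ h] := thompson_bij hf.
have [|x] := h 1; first by rewrite /= in_itv /= lexx ler01.
rewrite /= in_itv /= => x01 fx1.
have /andP[_ f1] := thompson_itv hf (x := 1) ltac:(lra).
apply/eqP; rewrite eq_le f1 /= -[leLHS]fx1 (thompson_mono hf) ?in_itv /=; lra.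
Qed.

Lemma thompson_dyadic f x : is_thompson f ->
  dyadic_fractions R x -> dyadic_fractions R (f x).
Proof.
move=> hf [dx x01]; split; last first.
  rewrite -{1}(thompson0 hf) -(thompson1 hf).
  by rewrite !(thompson_incr hf) ?in_itv /=; lra.
have [s sD pl] := thompson_pl hf.
pose m d := count (fun q => q < d) s.
have [n] := ubnP (m x); elim: n => // n IHn in x dx x01 * => mx.
have [p [pd ps pmax]] := last_breakpoint s (d := x) ltac:(lra).
have [k [c fE]] := pl p x ltac:(lra) ltac:(lra) ltac:(lra) pmax.
have dp : dyadic p by case: ps => [->|/sD[]//]; exact: dyadic0.
have dfp : dyadic (f p).
  case: ps => [->|ps]; first by rewrite (thompson0 hf); exact: dyadic0.
  have [_ p01] := sD _ ps.
  apply: IHn => //; rewrite ltnS in mx; apply: leq_trans mx; rewrite /m.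
  have : (count (fun q => q < p)%R s + count (pred1 p) s
      <= count (fun q => q < x)%R s)%N.
    rewrite -count_predUI [X in (_ + X)%N](_ : _ = 0%N) ?addn0.
      by apply: sub_count => q /= /orP[|/eqP->]; lra.
    apply/eqP; rewrite eqn0Ngt -has_count; apply/hasPn => q _ /=.
    by apply/negP => /andP[+ /eqP qp]; rewrite qp ltxx.
  move=> h; apply: leq_trans h; rewrite -[leqLHS]addn1 leq_add2l.
  by rewrite -has_count has_pred1.
have -> : f x = 2 ^ k * (x - p) + f p by rewrite !fE; [ring|lra|lra].
by apply: dyadicD => //; apply: dyadic_scale; apply/dyadicD/dyadicN.
Qed.

Lemma is_thompsonI f g :
    (forall t, ~~ (0 <= t <= 1) -> f t = t) ->
    (forall t, 0 <= t <= 1 -> 0 <= f t <= 1) ->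
    (forall t, 0 <= t <= 1 -> 0 <= g t <= 1) ->
    (forall t, 0 <= t <= 1 -> f (g t) = t) ->
    (forall x y, 0 <= x -> x < y -> y <= 1 -> f x < f y) ->
    (exists2 s : seq R,
    (forall p : R, p \in s -> dyadic_fractions R p) &
    forall a b : R, 0 <= a -> a < b -> b <= 1 ->
      (forall p : R, p \in s -> ~~ (a < p < b)) ->
      exists (k : int) (c : R), forall t : R, a <= t <= b -> f t = 2 ^ k * t + c) ->
  is_thompson f.
Proof.
move=> fout fI gI fg flt fpl.
have fincr : {in `[0, 1] &, {homo f : x y / x < y}}.
  by move=> x y; rewrite !in_itv /= => x01 y01 xy; apply: flt; lra.
have fmono : {in `[0, 1] &, {mono f : x y / x <= y}} by exact: le_mono_in.
have fsurj y : 0 <= y <= 1 -> exists2 x, x \in `[0, 1] & f x = y.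
  by move=> y01; exists (g y); [rewrite in_itv /= gI|rewrite fg].
have f0 : f 0 = 0.
  have [|x] := fsurj 0; first by rewrite lexx ler01.
  rewrite in_itv /= => x01 fx; have /andP[h _] := fI 0 ltac:(lra).
  apply/eqP; rewrite eq_le h andbT -[leRHS]fx fmono ?in_itv /=; lra.
have f1 : f 1 = 1.
  have [|x] := fsurj 1; first by rewrite lexx ler01.
  rewrite in_itv /= => x01 fx; have /andP[_ h] := fI 1 ltac:(lra).
  apply/eqP; rewrite eq_le h /= -[leLHS]fx fmono ?in_itv /=; lra.
split=> //.
- split.
  + by move=> t /=; rewrite !in_itv /=; exact: fI.
  + by move=> x y; rewrite !inE /= => x01 y01; exact: (inc_inj_in fmono).
  + by move=> y; rewrite /= in_itv /= => /fsurj[x x01 <-]; exists x.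
- apply: segment_inc_surj_continuous => //.
  by move=> y; rewrite /= f0 f1 in_itv /= => /fsurj[x x01 <-]; exists x.
Qed.

Lemma is_thompson_id : is_thompson (fun t : R => t).
Proof.
apply: (@is_thompsonI _ id) => //.
exists [::] => // a b _ _ _ _; exists 0, 0 => t _.
by rewrite expr0z mul1r addr0.
Qed.

Lemma thompson_lt f x y : is_thompson f -> 0 <= x -> x < y -> y <= 1 ->
  f x < f y.
Proof. by move=> hf *; apply: (thompson_incr hf) => //; rewrite in_itv /=; lra. Qed.

Lemma thompson_inv_ex f : is_thompson f -> exists g, cancel f g /\ cancel g f.
Proof.
move=> hf; have [_ _ fsurj] := thompson_bij hf.
have finj : injective f.
  move=> x y fxy.
  have [x01|x01] := boolP (0 <= x <= 1); have [y01|y01] := boolP (0 <= y <= 1).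
  - by apply: (inc_inj_in (thompson_mono hf)); rewrite ?in_itv.
  - by move: (y01); rewrite -(thompson_out hf y01) -fxy (thompson_itv hf x01).
  - by move: (x01); rewrite -(thompson_out hf x01) fxy (thompson_itv hf y01).
  - by rewrite -(thompson_out hf x01) fxy thompson_out.
have /choice[g gK] : forall y, exists x, f x = y.
  move=> y; case: (boolP (0 <= y <= 1)) => y01.
    by have [|x _ <-] := fsurj y; [rewrite /= in_itv|exists x].
  by exists y; exact: thompson_out.
by exists g; split => // x; apply: finj; rewrite gK.
Qed.

Lemma is_thompson_inv f g : is_thompson f -> cancel f g -> cancel g f ->
  is_thompson g.
Proof.
move=> hf fK gK.
have gout t : ~~ (0 <= t <= 1) -> g t = t.
  by move=> t01; rewrite -{1}(thompson_out hf t01) fK.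
have gI t : 0 <= t <= 1 -> 0 <= g t <= 1.
  move=> t01; apply/negPn/negP => gt01.
  by move: (gt01); rewrite -(thompson_out hf gt01) gK t01.
have glt x y : 0 <= x -> x < y -> y <= 1 -> g x < g y.
  move=> x0 xy y1; rewrite ltNge -(thompson_mono hf) ?in_itv /= ?gI //; try lra.
  by rewrite !gK -ltNge.
apply: (@is_thompsonI _ f) => //; first by move=> t; exact: thompson_itv.
have [s sD pl] := thompson_pl hf.
exists (map f s) => [_ /mapP[p ps ->]|a b a0 ab b1 sab].
  by apply: thompson_dyadic => //; exact: sD.
have ga := gI a ltac:(lra); have gb := gI b ltac:(lra).
have gab := glt a b a0 ab b1.
have [|k [c fE]] := pl (g a) (g b) ltac:(lra) gab ltac:(lra).
  move=> p ps; apply: contra (sab _ (map_f f ps)) => /andP[ap pb].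
  by rewrite -(gK a) -(gK b) !(thompson_lt hf) //; lra.
exists (- k), (- (2 ^ (- k) * c)) => t tab.
have fgt : f (g t) = 2 ^ k * g t + c.
  apply: fE; apply/andP; split.
    have [->//|ta] := eqVneq a t; apply/ltW/glt; move/eqP: ta; lra.
  have [->//|tb] := eqVneq t b; apply/ltW/glt; move/eqP: tb; lra.
rewrite -[in RHS](gK t) fgt mulrDr mulrA addrK -expfzDr ?pnatr_eq0 //.
by rewrite addNr expr0z mul1r.
Qed.

Lemma is_thompson_comp f g : is_thompson f -> is_thompson g ->
  is_thompson (g \o f).
Proof.
move=> hf hg.
have [f' [fK f'K]] := thompson_inv_ex hf.
have [g' [gK g'K]] := thompson_inv_ex hg.
have hf' := is_thompson_inv hf fK f'K.
have hg' := is_thompson_inv hg gK g'K.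
apply: (@is_thompsonI _ (f' \o g')) => /=.
- by move=> t t01; rewrite (thompson_out hf t01) (thompson_out hg t01).
- by move=> t t01; do 2 apply: thompson_itv => //.
- by move=> t t01; do 2 apply: thompson_itv => //.
- by move=> t _; rewrite f'K g'K.
- move=> x y x0 xy y1.
  have := thompson_itv hf (x := x) ltac:(lra).
  have := thompson_itv hf (x := y) ltac:(lra).
  have := thompson_lt hf x0 xy y1.
  by move=> *; apply: thompson_lt => //; lra.
have [s sD spl] := thompson_pl hf.
have [r rD rpl] := thompson_pl hg.
exists (s ++ map f' r) => [p|a b a0 ab b1 sab].
  rewrite mem_cat => /orP[/sD//|/mapP[q /rD qD ->]].
  exact: thompson_dyadic.
have [p ps|k [c fE]] := spl a b a0 ab b1.
  by apply: sab; rewrite mem_cat ps.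
have fa := thompson_itv hf (x := a) ltac:(lra).
have fb := thompson_itv hf (x := b) ltac:(lra).
have fab := thompson_lt hf a0 ab b1.
have [|l [d gE]] := rpl (f a) (f b) ltac:(lra) fab ltac:(lra).
  move=> q qr; have qD := rD _ qr; case: (qD) => _ q01.
  have /sab : f' q \in s ++ map f' r by rewrite mem_cat map_f ?orbT.
  apply: contra => /andP[aq qb].
  by rewrite -(fK a) -(fK b) !(thompson_lt hf') //; lra.
exists (l + k), (2 ^ l * c + d) => t tab; rewrite gE; last first.
  by rewrite !(thompson_mono hf) ?in_itv //=; lra.
by rewrite fE // expfzDr ?pnatr_eq0 //; ring.
Qed.

Definition x0_fun t : R :=
  if (t < 0) || (1 < t) then t
  else if t <= 1 / 4 then 2 * t
  else if t <= 1 / 2 then t + 1 / 4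
  else t / 2 + 1 / 2.

Definition x1_fun t : R :=
  if (t < 0) || (1 < t) then t
  else if t <= 1 / 2 then t
  else if t <= 5 / 8 then 2 * t - 1 / 2
  else if t <= 3 / 4 then t + 1 / 8
  else t / 2 + 1 / 2.

Let dyadic_fracI (m n : nat) : (0 < m < 2 ^ n)%N ->
  dyadic_fractions R (m%:R / 2 ^+ n).
Proof.
move=> /andP[m0 mn]; split; first by exists m, n.
rewrite divr_gt0 ?ltr0n ?exprn_gt0 //= ltr_pdivrMr ?exprn_gt0 // mul1r.
by rewrite -natrX ltr_nat.
Qed.

Lemma x0_funP : is_thompson x0_fun.
Proof.
apply: (@is_thompsonI _ (fun t : R => if t <= 1 / 2 then t / 2
   else if t <= 3 / 4 then t - 1 / 4 else 2 * t - 1)); rewrite /x0_fun.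
- by move=> t; case: ifP => //; lra.
- by move=> t; do ?[case: ifP]; lra.
- by move=> t; do ?[case: ifP]; lra.
- by move=> t; do ?[case: ifP]; lra.
- by move=> x y; do ?[case: ifP]; lra.
exists [:: 1 / 4; 1 / 2] => [p|a b a0 ab b1 sab].
  rewrite !inE => /orP[]/eqP->.
    by rewrite (_ : 1 / 4 = 1%:R / 2 ^+ 2); [exact: dyadic_fracI|field].
  by rewrite (_ : 1 / 2 = 1%:R / 2 ^+ 1); [exact: dyadic_fracI|field].
have h1 := sab (1 / 4) ltac:(by rewrite !inE eqxx ?orbT).
have h2 := sab (1 / 2) ltac:(by rewrite !inE eqxx ?orbT).
have [b4|b4] := lerP b (1 / 4).
  by exists 1, 0 => t tab; rewrite expr1z; do ?[case: ifP]; lra.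
have [b2|b2] := lerP b (1 / 2).
  by exists 0, (1 / 4) => t tab; rewrite expr0z; do ?[case: ifP]; lra.
by exists (-1), (1 / 2) => t tab; rewrite exprN1; do ?[case: ifP]; lra.
Qed.

Lemma x1_funP : is_thompson x1_fun.
Proof.
apply: (@is_thompsonI _ (fun t : R => if t <= 1 / 2 then t
   else if t <= 3 / 4 then t / 2 + 1 / 4
   else if t <= 7 / 8 then t - 1 / 8 else 2 * t - 1)); rewrite /x1_fun.
- by move=> t; case: ifP => //; lra.
- by move=> t; do ?[case: ifP]; lra.
- by move=> t; do ?[case: ifP]; lra.
- by move=> t; do ?[case: ifP]; lra.
- by move=> x y; do ?[case: ifP]; lra.
exists [:: 1 / 2; 5 / 8; 3 / 4] => [p|a b a0 ab b1 sab].
  rewrite !inE => /or3P[]/eqP->.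
  - by rewrite (_ : 1 / 2 = 1%:R / 2 ^+ 1); [exact: dyadic_fracI|field].
  - by rewrite (_ : 5 / 8 = 5%:R / 2 ^+ 3); [exact: dyadic_fracI|field].
  - by rewrite (_ : 3 / 4 = 3%:R / 2 ^+ 2); [exact: dyadic_fracI|field].
have h1 := sab (1 / 2) ltac:(by rewrite !inE eqxx ?orbT).
have h2 := sab (5 / 8) ltac:(by rewrite !inE eqxx ?orbT).
have h3 := sab (3 / 4) ltac:(by rewrite !inE eqxx ?orbT).
have [b2|b2] := lerP b (1 / 2).
  by exists 0, 0 => t tab; rewrite expr0z; do ?[case: ifP]; lra.
have [b8|b8] := lerP b (5 / 8).
  by exists 1, (- (1 / 2)) => t tab; rewrite expr1z; do ?[case: ifP]; lra.
have [b4|b4] := lerP b (3 / 4).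
  by exists 0, (1 / 8) => t tab; rewrite expr0z; do ?[case: ifP]; lra.
by exists (-1), (1 / 2) => t tab; rewrite exprN1; do ?[case: ifP]; lra.
Qed.

End ThompsonFacts.

HB.instance Definition _ (R : realType) := [isSub for @thompson_fun R].
HB.instance Definition _ (R : realType) := [Choice of thompsonF R by <:].

Section ThompsonGroup.
Variable R : realType.
Implicit Types f g h : thompsonF R.

Lemma thompsonF_is_thompson f : is_thompson f.
Proof. exact/asboolP/(thompson_funP f). Qed.

Lemma thompsonF_eq f g : f =1 g -> f = g.
Proof. by move=> fg; apply/val_inj/funext. Qed.

Definition thompson_one : thompsonF R :=
  ThompsonF (asboolT (@is_thompson_id R)).

(* Group elements are composed from left to right. *)
Definition thompson_mul f g : thompsonF R :=
  ThompsonF (asboolT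
    (is_thompson_comp (thompsonF_is_thompson f) (thompsonF_is_thompson g))).

Definition thompson_inv f : thompsonF R :=
  let g := cid (thompson_inv_ex (thompsonF_is_thompson f)) in
  ThompsonF (asboolT
    (is_thompson_inv (thompsonF_is_thompson f) (proj2_sig g).1 (proj2_sig g).2)).

Lemma thompson_invK f : cancel f (thompson_inv f).
Proof. by rewrite /thompson_inv /=; case: cid => g []. Qed.

Lemma thompson_invKV f : cancel (thompson_inv f) f.
Proof. by rewrite /thompson_inv /=; case: cid => g []. Qed.

Lemma thompson_mulA : associative thompson_mul.
Proof. by move=> f g h; exact: thompsonF_eq. Qed.

Lemma thompson_mul1 : left_id thompson_one thompson_mul.
Proof. by move=> f; exact: thompsonF_eq. Qed.

Lemma thompson_mulr1 : right_id thompson_one thompson_mul.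
Proof. by move=> f; exact: thompsonF_eq. Qed.

Lemma thompson_mulV : left_inverse thompson_one thompson_inv thompson_mul.
Proof. by move=> f; apply: thompsonF_eq => t /=; exact: thompson_invKV. Qed.

Lemma thompson_mulrV : right_inverse thompson_one thompson_inv thompson_mul.
Proof. by move=> f; apply: thompsonF_eq => t /=; exact: thompson_invK. Qed.

HB.instance Definition _ := isGroup.Build (thompsonF R)
  thompson_mulA thompson_mul1 thompson_mulr1 thompson_mulV thompson_mulrV.

Definition x0 : thompsonF R := ThompsonF (asboolT (@x0_funP R)).
Definition x1 : thompsonF R := ThompsonF (asboolT (@x1_funP R)).

End ThompsonGroup.
Arguments x0 : clear implicits.
Arguments x1 : clear implicits.

(** * Subgroups and the decision problem *)

Definition is_subgroup (G : groupType) (H : set G) : Prop :=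
  [/\ H 1%g, forall a b, H a -> H b -> H (a * b)%g & forall a, H a -> H a^-1%g].

Definition generated_subgroup (G : groupType) (X : set G) : set G :=
  smallest (@is_subgroup G) X.

Definition acts_transitively (R : realType) (H : set (thompsonF R))
    (D : set R) : Prop :=
  forall x y, D x -> D y -> exists2 h : thompsonF R, H h & h x = y.

(* A letter [(i, e)] denotes x_i if [e] is [false] and x_i^-1 if [e] is
   [true]. *)
Definition letter : Type := (bool * bool)%type.
Definition word : Type := seq letter.

Definition letter_val (R : realType) (l : letter) : thompsonF R :=
  let x := if l.1 then x1 R else x0 R in if l.2 then (x^-1)%g else x.

Definition word_val (R : realType) (w : word) : thompsonF R :=
  (\prod_(l <- w) letter_val R l)%g.

(* The finite subset of F presented by a list of words. *)
Definition words_val (R : realType) (ws : seq word) : set (thompsonF R) :=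
  [set word_val R w | w in [set` ws]].
Arguments words_val : clear implicits.

Definition letter_code (l : letter) : nat := (l.1 + 2 * l.2)%N.
Definition word_code (w : word) : nat := CodeSeq.code (map letter_code w).
Definition words_code (ws : seq word) : nat :=
  CodeSeq.code (map word_code ws).

Lemma letter_code_inj : injective letter_code.
Proof. by move=> [[] []] [[] []]. Qed.

Lemma words_code_inj : injective words_code.
Proof.
apply: inj_comp (can_inj CodeSeq.codeK) _; apply: inj_map.
apply: inj_comp (can_inj CodeSeq.codeK) _; apply: inj_map.
exact: letter_code_inj.
Qed.

(* Main.v *)
Require Import Defs.
From mathcomp Require Import all_boot all_order all_algebra.
From mathcomp Require Import all_classical all_reals all_analysis.
From mathcomp Require Import zify ring lra.

Set Implicit Arguments.
Unset Strict Implicit.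
Unset Printing Implicit Defensive.
Import Order.TTheory GRing.Theory Num.Theory.

(** A binary word [p] is read both as the dyadic number [pt R p] with binary
expansion 0.p and as the interval of the numbers whose expansion begins with
[p].  A letter of F replaces a prefix of the expansion by another one, of
length at most three, and changes the length by at most one.  Hence the element
given by a word [w] replaces every prefix [p] of a large enough length L by
[word_act w p], whatever follows ([word_pt], [word_act_cat]).

Let H be the subgroup generated by the given words.  A finite automaton reading
binary words, with coloured states, colours the dyadic numbers as soon as
reading a 0 never changes the colour.  If moreover it reaches the same state on
[p] and on [word_act w p], for all given [w] and all [p] of length L, then the
colouring is H-invariant ([colour_invariant]).  Therefore an automaton that
gives two colours to the dyadic fractions proves that H is not transitive
([separated_not_transitive]).

Conversely, if H is not transitive, then such an automaton exists with at most
2^(2L+1) states ([not_transitive_separated]).  Call two words equivalent when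
an element of H maps the interval of the first affinely onto that of the
second, that is, replaces the first prefix by the second.  This is a right
congruence on words, and it contains the pairs ([p], [word_act w p]), whose
words have length at most M = 2L.  The states are the least words of the
classes that meet the words of length at most M, together with a sink; a state
of length less than M is followed as the congruence demands.  There are two
cases.
- Every word of length M is equivalent to a shorter one.  Then the congruence
  has finite index, the automaton computes classes, and membership in the orbit
  of 1/2 is a colouring, which is not constant as H is not transitive.
- Some word [p] of length M is least in its class.  Nothing constrains the
  transitions out of its state, since the words of the rules are too short to
  use them: let 0 stay and 1 lead to the sink, and give the sink a colour of its
  own.  Then [p] followed by 1 and the word 1 have different colours.

So H is transitive if and only if no automaton of this bounded size separates
two dyadic fractions.  Automata are coded by natural numbers, and the search
for one is a bounded search for a solution of an arithmetical condition
([separates]), which is recursive ([recursive_decide]). *)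

(** * Recursive functions of an environment *)

(** Expressions with free variables are functions of an environment [v], the list
of the values of the variables; the variable of de Bruijn index [i] is
[nth 0 v i], and a binder conses a value on the environment.  Lists rather than
tuples keep lengths out of the expressions. *)
Definition rcv n (F : seq nat -> nat) := recursive (fun v : n.-tuple nat => F v).

Lemma rcv_ext n F G : F =1 G -> rcv n F -> rcv n G.
Proof. by move=> /funext ->. Qed.

Lemma rcv_var n i : i < n -> rcv n (fun v => nth 0 v i).
Proof.
move=> lt_in; apply: (rec_proj (i := Ordinal lt_in)) => v.
by rewrite (tnth_nth 0).
Qed.

Lemma rcv_nth_behead n i (G : seq nat -> seq nat) :
  rcv n (fun v => nth 0 (G v) i.+1) -> rcv n (fun v => nth 0 (behead (G v)) i).
Proof. by apply: rcv_ext => v; rewrite nth_behead. Qed.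

Lemma rcv_comp n (G : seq nat -> nat) (hs : seq (seq nat -> nat)) :
    rcv (size hs) G ->
    (forall i, i < size hs -> rcv n (nth (fun=> 0) hs i)) ->
  rcv n (fun v => G [seq h v | h <- hs]).
Proof.
move=> recG rech.
apply: (rec_comp (h := fun (i : 'I_(size hs)) v => nth (fun=> 0) hs i v) recG).
  by move=> i; apply: rech.
move=> v; congr G; apply: (@eq_from_nth _ 0); first by rewrite size_map size_tuple.
move=> i; rewrite size_map => lt_i.
rewrite (nth_map (fun=> 0)) // -[i]/(nat_of_ord (Ordinal lt_i)).
by rewrite -tnth_nth tnth_mktuple.
Qed.

(** Together with its analogues for more arguments, this reduces the recursiveness
of a named function, applied to arbitrary expressions, to that of the function
applied to variables. *)
Lemma rcv_fun1 n (f : nat -> nat) A :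
  rcv 1 (fun v => f (nth 0 v 0)) -> rcv n A -> rcv n (fun v => f (A v)).
Proof.
move=> recf recA; apply: (rcv_comp (hs := [:: A]) recf).
by case.
Qed.

Lemma rcv_fun2 n (f : nat -> nat -> nat) A B :
    rcv 2 (fun v => f (nth 0 v 0) (nth 0 v 1)) -> rcv n A -> rcv n B ->
  rcv n (fun v => f (A v) (B v)).
Proof.
move=> recf recA recB; apply: (rcv_comp (hs := [:: A; B]) recf).
by case=> [|[]].
Qed.

Lemma rcv_fun3 n (f : nat -> nat -> nat -> nat) A B C :
    rcv 3 (fun v => f (nth 0 v 0) (nth 0 v 1) (nth 0 v 2)) ->
    rcv n A -> rcv n B -> rcv n C ->
  rcv n (fun v => f (A v) (B v) (C v)).
Proof.
move=> recf recA recB recC; apply: (rcv_comp (hs := [:: A; B; C]) recf).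
by case=> [|[|[]]].
Qed.

Lemma rcv_fun4 n (f : nat -> nat -> nat -> nat -> nat) A B C D :
    rcv 4 (fun v => f (nth 0 v 0) (nth 0 v 1) (nth 0 v 2) (nth 0 v 3)) ->
    rcv n A -> rcv n B -> rcv n C -> rcv n D ->
  rcv n (fun v => f (A v) (B v) (C v) (D v)).
Proof.
move=> recf recA recB recC recD; apply: (rcv_comp (hs := [:: A; B; C; D]) recf).
by case=> [|[|[|[]]]].
Qed.

Definition vars k n : seq (seq nat -> nat) :=
  [seq (fun v => nth 0 v i) | i <- iota k n].

Lemma vars_val k n (v : seq nat) : size v = k + n ->
  [seq h v | h <- vars k n] = drop k v.
Proof.
move=> sz_v; rewrite -map_comp; apply: (@eq_from_nth _ 0).
  by rewrite size_map size_iota size_drop sz_v addKn.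
rewrite size_map size_iota => i lt_i.
by rewrite (nth_map 0) ?size_iota //= nth_iota // nth_drop.
Qed.

Lemma rcv_vars k n m i : k + n <= m -> i < size (vars k n) ->
  rcv m (nth (fun=> 0) (vars k n) i).
Proof.
move=> le_m; rewrite size_map size_iota => lt_i.
rewrite (nth_map 0) ?size_iota // nth_iota //; apply: rcv_var.
by apply: leq_trans le_m; rewrite ltn_add2l.
Qed.

(** Only environments of length [n] matter. *)
Lemma rcv_tuple n (F G : seq nat -> nat) :
  (forall v : n.-tuple nat, F v = G v) -> rcv n F -> rcv n G.
Proof. by move=> FG; rewrite /rcv (funext FG). Qed.

Lemma rcv_weak n F : rcv n F -> rcv n.+1 (fun v => F (behead v)).
Proof.
move=> recF.
have sz : size (vars 1 n) = n by rewrite size_map size_iota.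
have /rcv_tuple : rcv n.+1 (fun v => F [seq h v | h <- vars 1 n]).
  by apply: rcv_comp; [rewrite sz | move=> i; apply: rcv_vars].
by apply=> v; rewrite vars_val ?size_tuple // drop1.
Qed.

Lemma rcv_weak2 n F : rcv n F -> rcv n.+2 (fun v => F (behead (behead v))).
Proof. by move=> /rcv_weak/rcv_weak. Qed.

(** Substitution for the two innermost variables; it also serves to permute them
or to forget one. *)
Lemma rcv_subst2 n (H : nat -> nat -> seq nat -> nat) A B :
    rcv n.+2 (fun v => H (nth 0 v 0) (nth 0 v 1) (behead (behead v))) ->
    rcv n.+2 A -> rcv n.+2 B ->
  rcv n.+2 (fun v => H (A v) (B v) (behead (behead v))).
Proof.
move=> recH recA recB.
have sz : size (A :: B :: vars 2 n) = n.+2 by rewrite /= size_map size_iota.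
pose G (v : seq nat) := H (nth 0 v 0) (nth 0 v 1) (behead (behead v)).
have /rcv_tuple : rcv n.+2 (fun v => G [seq h v | h <- A :: B :: vars 2 n]).
  apply: rcv_comp; first by rewrite sz.
  by case=> [|[|i]] //=; exact: rcv_vars.
by apply=> v; rewrite map_cons map_cons vars_val ?size_tuple // -drop1 -drop1 drop_drop.
Qed.

Lemma rcv_prim n G H :
    rcv n G ->
    rcv n.+2 (fun v => H (nth 0 v 0) (nth 0 v 1) (behead (behead v))) ->
  rcv n.+1 (fun v => iteri (nth 0 v 0) (fun k r => H k r (behead v)) (G (behead v))).
Proof. by move=> recG recH; apply: (rec_prim recG recH). Qed.

(** Primitive recursion in the form of a loop whose body sees the counter, the
accumulator and the environment. *)
Lemma rcv_iteri n A H G :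
    rcv n A -> rcv n G ->
    rcv n.+2 (fun v => H (nth 0 v 0) (nth 0 v 1) (behead (behead v))) ->
  rcv n (fun v => iteri (A v) (fun k r => H k r v) (G v)).
Proof.
move=> recA recG recH.
have := rcv_prim recG recH; set P := (fun v : seq nat => iteri _ _ _) => recP.
have sz : size (A :: vars 0 n) = n.+1 by rewrite /= size_map size_iota.
have /rcv_tuple : rcv n (fun v => P [seq h v | h <- A :: vars 0 n]).
  apply: rcv_comp; first by rewrite sz.
  by case=> [|i] //=; exact: rcv_vars.
by apply=> v; rewrite map_cons vars_val ?size_tuple // drop0.
Qed.

Lemma rcv_succ n A : rcv n A -> rcv n (fun v => (A v).+1).
Proof.
apply: (@rcv_fun1 n S); apply: rec_succ => v.
by rewrite (tnth_nth 0).
Qed.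

Lemma rcv_const n c : rcv n (fun=> c).
Proof. by elim: c => [|c IHc]; [exact: rec_zero | exact: rcv_succ]. Qed.

(* [rcv] decomposes an expression along its syntax.  The hooks [rcv_op] and
[rcv_named] are redefined once more operations are known to be recursive. *)
Ltac rcv_op := fail.
Ltac rcv := repeat
  lazymatch goal with
  | H : rcv ?n ?F |- rcv ?n ?F => exact: H
  | |- rcv _ (fun v => nth 0 v _) => by apply: rcv_var
  | |- rcv _ (fun v => nth 0 (behead (@?G v)) _) => apply: rcv_nth_behead
  | |- rcv _ (fun _ => ?c) => apply: rcv_const
  | |- rcv _ (fun v => S _) => apply: rcv_succ
  | |- rcv _ (fun v => iteri _ _ _) => apply: rcv_iteri
  | _ => rcv_op
  end.

Lemma rcv_add n A B : rcv n A -> rcv n B -> rcv n (fun v => A v + B v).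
Proof.
apply: rcv_fun2.
apply: (@rcv_ext _ (fun v => iteri (nth 0 v 1) (fun _ r => r.+1) (nth 0 v 0))).
  by move=> v; elim: (nth 0 v 1) => [|k /= ->]; rewrite ?addn0 ?addnS.
by rcv.
Qed.

Lemma rcv_mul n A B : rcv n A -> rcv n B -> rcv n (fun v => A v * B v).
Proof.
apply: rcv_fun2.
apply: (@rcv_ext _ (fun v => iteri (nth 0 v 1) (fun _ r => r + nth 0 v 0) 0)).
  by move=> v; elim: (nth 0 v 1) => [|k /= ->]; rewrite ?muln0 ?mulnSr.
by rcv; apply: rcv_add; rcv.
Qed.

Lemma rcv_exp n A B : rcv n A -> rcv n B -> rcv n (fun v => A v ^ B v).
Proof.
apply: rcv_fun2.
apply: (@rcv_ext _ (fun v => iteri (nth 0 v 1) (fun _ r => r * nth 0 v 0) 1)).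
  by move=> v; elim: (nth 0 v 1) => [|k /= ->]; rewrite ?expnSr.
by rcv; apply: rcv_mul; rcv.
Qed.

Lemma rcv_pred n A : rcv n A -> rcv n (fun v => (A v).-1).
Proof.
apply: rcv_fun1.
apply: (@rcv_ext _ (fun v => iteri (nth 0 v 0) (fun k _ => k) 0)).
  by move=> v; case: (nth 0 v 0).
by rcv.
Qed.

Lemma rcv_sub n A B : rcv n A -> rcv n B -> rcv n (fun v => A v - B v).
Proof.
apply: rcv_fun2.
apply: (@rcv_ext _ (fun v => iteri (nth 0 v 1) (fun _ r => r.-1) (nth 0 v 0))).
  by move=> v; elim: (nth 0 v 1) => [|k /= ->]; rewrite ?subn0 ?subnS.
by rcv; apply: rcv_pred; rcv.
Qed.

Notation rcvb n P := (rcv n (fun v => nat_of_bool (P v))).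

Lemma rcv_not n P : rcvb n P -> rcvb n (fun v => ~~ P v).
Proof.
move=> recP; apply: (@rcv_ext _ (fun v => 1 - P v)); first by move=> v; case: (P v).
by apply: rcv_sub; rcv.
Qed.

Lemma rcv_and n P Q : rcvb n P -> rcvb n Q -> rcvb n (fun v => P v && Q v).
Proof.
move=> recP recQ; apply: (@rcv_ext _ (fun v => P v * Q v)).
  by move=> v; rewrite mulnb.
exact: rcv_mul.
Qed.

Lemma rcv_leq n A B : rcv n A -> rcv n B -> rcvb n (fun v => A v <= B v).
Proof.
move=> recA recB; apply: (@rcv_ext _ (fun v => 1 - (A v - B v))).
  by move=> v; rewrite /leq; case: (A v - B v).
by apply: rcv_sub; rcv; exact: rcv_sub.
Qed.

Lemma rcv_eq n A B : rcv n A -> rcv n B -> rcvb n (fun v => A v == B v).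
Proof.
move=> recA recB; apply: (@rcv_ext _ (fun v => (A v <= B v) && (B v <= A v))).
  by move=> v; rewrite eqn_leq.
by apply: rcv_and; exact: rcv_leq.
Qed.

Lemma rcv_if n P A B : rcvb n P -> rcv n A -> rcv n B ->
  rcv n (fun v => if P v then A v else B v).
Proof.
move=> recP recA recB; apply: (@rcv_ext _ (fun v => P v * A v + (~~ P v) * B v)).
  by move=> v; case: (P v); rewrite /= !mul0n mul1n ?addn0.
by apply: rcv_add; apply: rcv_mul => //; exact: rcv_not.
Qed.

Lemma rcv_all n A P : rcv n A ->
    rcvb n.+1 (fun v => P (nth 0 v 0) (behead v)) ->
  rcvb n (fun v => all (fun k => P k v) (iota 0 (A v))).
Proof.
move=> recA recP.
apply: (@rcv_ext _ (fun v => iteri (A v) (fun k r => r * P k v) 1)).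
  move=> v; elim: (A v) => // k; rewrite iteriS => ->.
  by rewrite -addn1 iotaD all_cat /= andbT add0n mulnb.
rcv; apply: rcv_mul; rcv.
apply: (@rcv_subst2 n (fun a b v => P b v) (nth 0 ^~ 1) (nth 0 ^~ 0)); rcv.
by apply: rcv_ext (rcv_weak recP) => v /=; rewrite nth_behead.
Qed.

Lemma rcv_has n A P : rcv n A ->
    rcvb n.+1 (fun v => P (nth 0 v 0) (behead v)) ->
  rcvb n (fun v => has (fun k => P k v) (iota 0 (A v))).
Proof.
move=> recA recP.
apply: (@rcv_ext _ (fun v => ~~ all (fun k => ~~ P k v) (iota 0 (A v)))).
  by move=> v; rewrite -has_predC; congr nat_of_bool; apply: eq_has => k /=; rewrite negbK.
by apply: rcv_not; apply: rcv_all => //; apply: rcv_not.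
Qed.

(** The quotient by a nonzero divisor counts its positive multiples up to the
dividend. *)
Lemma rcv_div n A B : rcv n A -> rcv n B -> rcv n (fun v => A v %/ B v).
Proof.
apply: rcv_fun2.
apply: (@rcv_ext _ (fun v => iteri (nth 0 v 0)
   (fun k r => r + (0 < nth 0 v 1) && (k.+1 * nth 0 v 1 <= nth 0 v 0)) 0)).
  move=> v; set a := nth 0 v 0; set b := nth 0 v 1.
  have [->|b0] := posnP b.
    by rewrite divn0; elim: {1}a => //= k ->.
  suff E N : iteri N (fun k r => r + (true && (k.+1 * b <= a))) 0 = minn N (a %/ b).
    by rewrite E (minn_idPr _) // leq_div.
  elim: N => [|N]; first by rewrite min0n.
  rewrite iteriS => -> /=; rewrite -leq_divRL //.
  by case: (ltnP N (a %/ b)) => ?; lia.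
rcv; apply: rcv_add; rcv; apply: rcv_and; apply: rcv_leq; rcv.
by apply: rcv_mul; rcv.
Qed.

Lemma rcv_mod n A B : rcv n A -> rcv n B -> rcv n (fun v => A v %% B v).
Proof.
move=> recA recB; apply: (@rcv_ext _ (fun v => A v - A v %/ B v * B v)).
  by move=> v; rewrite {1}(divn_eq (A v) (B v)) addKn.
by apply: rcv_sub => //; apply: rcv_mul => //; apply: rcv_div.
Qed.

Ltac rcv_named := fail.
Ltac rcv_op ::=
  lazymatch goal with
  | |- rcv _ (fun v => addn _ _) => apply: rcv_add
  | |- rcv _ (fun v => muln _ _) => apply: rcv_mul
  | |- rcv _ (fun v => expn _ _) => apply: rcv_exp
  | |- rcv _ (fun v => predn _) => apply: rcv_pred
  | |- rcv _ (fun v => subn _ _) => apply: rcv_sub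
  | |- rcv _ (fun v => divn _ _) => apply: rcv_div
  | |- rcv _ (fun v => modn _ _) => apply: rcv_mod
  | |- rcv _ (fun v => nat_of_bool (~~ _)) => apply: rcv_not
  | |- rcv _ (fun v => nat_of_bool (_ && _)) => apply: rcv_and
  | |- rcv _ (fun v => nat_of_bool (_ <= _)) => apply: rcv_leq
  | |- rcv _ (fun v => nat_of_bool (_ == _)) => apply: rcv_eq
  | |- rcv _ (fun v => nat_of_bool (all _ (iota 0 _))) => apply: rcv_all
  | |- rcv _ (fun v => nat_of_bool (has _ (iota 0 _))) => apply: rcv_has
  | |- rcv _ (fun v => if _ then _ else _) => apply: rcv_if
  | _ => rcv_named
  end.

(** The valuation counts the nontrivial powers of 2 that divide the number. *)
Lemma rcv_log2 n A : rcv n A -> rcv n (fun v => logn 2 (A v)).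
Proof.
apply: rcv_fun1.
apply: (@rcv_ext _ (fun v => iteri (nth 0 v 0)
  (fun k r => r + (0 < nth 0 v 0) && (nth 0 v 0 %% 2 ^ k.+1 == 0)) 0)).
  move=> v; set a := nth 0 v 0.
  have [->|a0] := posnP a; first by rewrite logn0.
  suff E N : iteri N (fun k r => r + (true && (a %% 2 ^ k.+1 == 0))) 0 = minn N (logn 2 a).
    by rewrite E (minn_idPr _) // ltnW // ltn_logl.
  elim: N => [|N]; first by rewrite min0n.
  rewrite iteriS => -> /=; rewrite -/(dvdn _ _) pfactor_dvdn //.
  by case: (ltnP N (logn 2 a)) => ?; lia.
rcv.
Qed.

(** As the code of [x :: s] is [2 ^ x] times an odd number, the head of a coded
list is a 2-adic valuation, and the tail is obtained by divisions. *)
Definition code_tail c := (c %/ 2 ^ logn 2 c) %/ 2.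
Definition code_drop i c := iteri i (fun _ r => code_tail r) c.

Lemma code_tailE x s : code_tail (CodeSeq.code (x :: s)) = CodeSeq.code s.
Proof.
rewrite /code_tail /= lognM ?expn_gt0 // pfactorK // [logn _ _.*2.+1]lognE /=.
by rewrite dvdn2 /= odd_double /= addn0 mulKn ?expn_gt0 // divn2 /= uphalf_double.
Qed.

Lemma code_head x s : logn 2 (CodeSeq.code (x :: s)) = x.
Proof.
rewrite /= lognM ?expn_gt0 // pfactorK // [logn _ _.*2.+1]lognE /=.
by rewrite dvdn2 /= odd_double /= addn0.
Qed.

Lemma code_dropE i s : code_drop i (CodeSeq.code s) = CodeSeq.code (drop i s).
Proof.
elim: i => [|i]; rewrite /code_drop ?drop0 //= => ->.
have [lt_i|le_i] := ltnP i (size s).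
  by rewrite (drop_nth 0) // code_tailE.
by rewrite !drop_oversize //; exact: leqW.
Qed.

Lemma size_code s : size s <= CodeSeq.code s.
Proof.
elim: s => //= x s IHs.
by rewrite -[(size s).+1]mul1n leq_mul ?expn_gt0 // ltnS -addnn (leq_trans IHs) ?leq_addr.
Qed.

Lemma rcv_code_tail n A : rcv n A -> rcv n (fun v => code_tail (A v)).
Proof. by apply: rcv_fun1; rewrite /code_tail; rcv; apply: rcv_log2; rcv. Qed.

Lemma rcv_code_drop n A B : rcv n A -> rcv n B -> rcv n (fun v => code_drop (A v) (B v)).
Proof. by apply: rcv_fun2; rewrite /code_drop; rcv; apply: rcv_code_tail; rcv. Qed.

(** A left fold over a coded list is a loop with the fold's accumulator as its only
state: the current item depends on the counter alone.  A code bounds the length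
of its list, so the code itself is a sufficient number of turns; the turns after
the end of the list do nothing. *)
Lemma foldl_decode (f : nat -> nat -> nat) a c :
  foldl f a (CodeSeq.decode c) =
  iteri c (fun i r => if code_drop i c == 0 then r else f r (logn 2 (code_drop i c))) a.
Proof.
rewrite -{2 3 4}(CodeSeq.decodeK c); move: (CodeSeq.decode c) => s.
suff E N : iteri N (fun i r => if code_drop i (CodeSeq.code s) == 0 then r
    else f r (logn 2 (code_drop i (CodeSeq.code s)))) a = foldl f a (take N s).
  by rewrite E take_oversize // size_code.
elim: N => [|N]; first by rewrite take0.
rewrite iteriS => ->; rewrite code_dropE.
have [lt_N|le_N] := ltnP N (size s).
  rewrite (drop_nth 0) // code_head (take_nth 0) // foldl_rcons /=.
  by rewrite muln_eq0 expn_eq0.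
by rewrite drop_oversize // !take_oversize // leqW.
Qed.

Lemma rcv_foldl_decode n C G H :
    rcv n C -> rcv n G ->
    rcv n.+2 (fun v => H (nth 0 v 0) (nth 0 v 1) (behead (behead v))) ->
  rcv n (fun v => foldl (fun r x => H r x v) (G v) (CodeSeq.decode (C v))).
Proof.
move=> recC recG recH.
apply: (@rcv_ext _ (fun v => iteri (C v) (fun i r => if code_drop i (C v) == 0 then r
  else H r (logn 2 (code_drop i (C v))) v) (G v))).
  by move=> v; rewrite foldl_decode.
have recC2 := rcv_weak2 recC.
have recD : rcv n.+2 (fun v => code_drop (nth 0 v 0) (C (behead (behead v)))).
  by apply: rcv_code_drop; rcv.
rcv => //.
apply: (@rcv_subst2 n H (nth 0 ^~ 1)) => //; rcv.
exact: rcv_log2.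
Qed.

Lemma rcv_all_decode n C P : rcv n C ->
    rcvb n.+1 (fun v => P (nth 0 v 0) (behead v)) ->
  rcvb n (fun v => all (fun x => P x v) (CodeSeq.decode (C v))).
Proof.
move=> recC recP.
apply: (@rcv_ext _ (fun v => foldl (fun r x => r * P x v) 1 (CodeSeq.decode (C v)))).
  move=> v; elim/last_ind: (CodeSeq.decode _) => // s x IHs.
  by rewrite foldl_rcons IHs mulnb all_rcons andbC.
apply: rcv_foldl_decode => //; rcv.
by apply: rcv_ext (rcv_weak recP) => v /=; rewrite nth_behead.
Qed.

(** * The action of letters on binary words *)

(** [x0_act false] is the action of x_0 on binary expansions, and [x0_act true]
that of its inverse.  The default case concerns only words that are too short
to determine the prefix to be replaced. *)
Definition x0_act (e : bool) (p : seq bool) : seq bool :=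
  match e, p with
  | false, false :: false :: s => false :: s
  | false, false :: true :: s => true :: false :: s
  | false, true :: s => true :: true :: s
  | true, false :: s => false :: false :: s
  | true, true :: false :: s => false :: true :: s
  | true, true :: true :: s => true :: s
  | _, _ => p
  end.

(** x_1 fixes [0, 1/2] and acts on [1/2, 1] as x_0 does on [0, 1], that is, on the
expansion after an initial 1. *)
Definition letter_act (l : letter) (p : seq bool) : seq bool :=
  if l.1 then (if p is true :: s then true :: x0_act l.2 s else p)
  else x0_act l.2 p.

Definition word_act (w : word) (p : seq bool) : seq bool :=
  foldl (fun q l => letter_act l q) p w.

Lemma letter_act_cat l p s : 2 < size p -> letter_act l (p ++ s) = letter_act l p ++ s.
Proof. by case: l => [[] []]; case: p => [|[] [|[] [|[] p]]]. Qed.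

Lemma size_letter_act l p : 2 < size p ->
  (size p).-1 <= size (letter_act l p) <= (size p).+1.
Proof. by case: l => [[] []]; case: p => [|[] [|[] [|[] p]]] //= _; lia. Qed.

Lemma x0_actK e p : 1 < size p -> x0_act (~~ e) (x0_act e p) = p.
Proof. by case: e; case: p => [|[] [|[] p]]. Qed.

Lemma size_word_act w p : size w + 2 < size p -> size (word_act w p) <= size p + size w.
Proof.
elim: w p => [|l w IHw] p /= sz_p; first by rewrite addn0.
have /andP[h1 h2] := size_letter_act l (p := p) ltac:(lia).
by have := IHw (letter_act l p) ltac:(lia); rewrite /word_act; lia.
Qed.

(** Each letter rewrites a prefix of at most three bits and shortens the word by at
most one bit, so that in a word of this length no letter of [w] reaches the
end. *)
Lemma word_act_cat w p s : size w + 2 < size p -> word_act w (p ++ s) = word_act w p ++ s.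
Proof.
elim: w p => //= l w IHw p sz_p.
have /andP[h1 h2] := size_letter_act l (p := p) ltac:(lia).
by rewrite -/(word_act w _) letter_act_cat ?IHw //; lia.
Qed.

(** * Binary words as natural numbers *)

(** The number with binary digits [p], the least significant first, followed by a
final digit 1 that marks the length.  Prefix replacements become arithmetic
modulo 4 or 8. *)
Definition bcode (p : seq bool) : nat := foldr (fun (a : bool) m => a + 2 * m) 1 p.

Lemma bcode_gt0 p : 0 < bcode p.
Proof. by elim: p => //= a p; lia. Qed.

Lemma bcode_bounds p : 2 ^ size p <= bcode p < 2 ^ (size p).+1.
Proof. by elim: p => //= a p; rewrite !expnS; case: a; lia. Qed.

Lemma bcode_surj m : 0 < m -> exists p, bcode p = m.
Proof.
have [n] := ubnP m; elim: n m => // n IHn m lt_m m_gt0.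
have [->|m1] := eqVneq m 1; first by exists [::].
have [||p pE] := IHn m./2; [lia|lia|].
by exists (odd m :: p); rewrite /= pE; lia.
Qed.

Lemma bcode_inj : injective bcode.
Proof.
elim=> [|a p IHp] [|b q] //=; [have := bcode_gt0 q; lia|have := bcode_gt0 p; lia|].
move=> E; have ab : a = b by move: a b E => [] [] //=; lia.
by congr (_ :: _) => //; apply: IHp; move: E; rewrite ab; lia.
Qed.

Lemma bcode_lt p k : (bcode p < 2 ^ k) = (size p < k).
Proof.
have /andP[h1 h2] := bcode_bounds p; apply/idP/idP => h.
  by rewrite -(ltn_exp2l _ _ (isT : 1 < 2)) (leq_ltn_trans h1).
by apply: leq_trans h2 _; rewrite leq_exp2l.
Qed.

(** Beyond the end, the quotient would be 0, while the empty word has number 1. *)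
Lemma bcode_drop i p : bcode (drop i p) = if i < size p then bcode p %/ 2 ^ i else 1.
Proof.
elim: i p => [|i IHi] [|a p] //=; first by rewrite divn1.
rewrite IHi ltnS; case: ifP => // _; rewrite expnS divnMA.
by congr (_ %/ _); lia.
Qed.

(** The cases follow the two leading bits of the word, the last two binary digits
of the number: 4q, 4q+2 and 2q+1 become 2q, 4q+1 and 4q+3. *)
Definition x0_actn (e m : nat) : nat :=
  if e == 0 then
    (if m %% 4 == 0 then m %/ 2 else if m %% 4 == 2 then m.-1 else 2 * m + 1)
  else (if m %% 2 == 0 then 2 * m else if m %% 4 == 1 then m.+1 else m %/ 2).

Definition letter_actn (l m : nat) : nat :=
  if l %% 2 == 1 then
    (if m %% 2 == 1 then 2 * x0_actn (l %/ 2) (m %/ 2) + 1 else m)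
  else x0_actn (l %/ 2) m.

Definition word_actn (c m : nat) : nat :=
  foldl (fun m l => letter_actn l m) m (CodeSeq.decode c).

Lemma x0_actnE (e : bool) p : 1 < size p -> x0_actn e (bcode p) = bcode (x0_act e p).
Proof.
case: p => [|a [|b p]] // _; rewrite /x0_actn /=.
by case: e; case: a; case: b => /=; do ?[case: ifP]; lia.
Qed.

Lemma letter_actnE l p : 2 < size p ->
  letter_actn (letter_code l) (bcode p) = bcode (letter_act l p).
Proof.
case: l p => b e [|a p] // sz_p;
rewrite /letter_actn /letter_code /letter_act [_.1]/= [_.2]/=.
have -> : (b + 2 * e) %/ 2 = e by case: b; case: e.
have -> : ((b + 2 * e) %% 2 == 1) = b by case: b; case: e.
case: b; last by rewrite x0_actnE // ltnW.
rewrite /=; have -> : (a + 2 * bcode p) %/ 2 = bcode p by clear sz_p; case: a; lia.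
have -> : ((a + 2 * bcode p) %% 2 == 1) = a by clear sz_p; case: a; lia.
by case: a sz_p => /= sz_p; rewrite ?x0_actnE //; lia.
Qed.

Lemma word_actnE w p : size w + 2 < size p ->
  word_actn (word_code w) (bcode p) = bcode (word_act w p).
Proof.
rewrite /word_actn /word_code CodeSeq.codeK.
elim: w p => //= l w IHw p sz_p.
have /andP[h1 h2] := size_letter_act l (p := p) ltac:(lia).
by rewrite letter_actnE ?IHw //; lia.
Qed.

(** * Automata as natural numbers *)

Definition digit (K T i : nat) : nat := (T %/ K ^ i) %% K.
(** The table [T], in base [K], has three digits for each state: the successors by
0 and by 1, and the colour. *)
Definition delta (K T q a : nat) : nat := digit K T (3 * q + a).
Definition colour (K T q : nat) : nat := digit K T (3 * q + 2).

(** The state reached from the initial state 1 on the word of number [m].  At turn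
[i] the unread part has the number [m %/ 2 ^ i], which is 1 at the end of the
word. *)
Definition run (K T m : nat) : nat :=
  iteri m (fun i q => if m %/ 2 ^ i <= 1 then q
                      else delta K T q (m %/ 2 ^ i %% 2)) 1.

Lemma runE K T p :
  run K T (bcode p) = foldl (fun q (a : bool) => delta K T q a) 1 p.
Proof.
rewrite /run; set f := fun i q => _.
have size_le : size p <= bcode p.
  by have /andP[h _] := bcode_bounds p; apply: leq_trans h; apply/ltnW/ltn_expl.
suff E N : iteri N f 1 = foldl (fun q (a : bool) => delta K T q a) 1 (take N p).
  by rewrite E take_oversize.
elim: N => [|N]; first by rewrite take0.
rewrite iteriS => ->; rewrite /f; have := bcode_drop N p.
have [lt_N <-|le_N _] := ltnP N (size p).
  rewrite (drop_nth false) // (take_nth false) // foldl_rcons /=.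
  set a := nth _ _ _; have := bcode_gt0 (drop N.+1 p).
  by case: ifP => [|_ _]; [lia | congr delta; case: a; lia].
rewrite !take_oversize ?(leqW le_N) //; case: ifP => // /negP[].
have /andP[_ h] := bcode_bounds p.
rewrite -ltnS ltn_divLR ?expn_gt0 // -expnS; apply: leq_trans h _.
by rewrite leq_exp2l.
Qed.

Lemma digits_ex K N (f : nat -> nat) : (forall i, i < N -> f i < K) ->
  exists2 T, T < K ^ N & forall i, i < N -> digit K T i = f i.
Proof.
elim: N f => [|N IHN] f fK; first by exists 0.
have f0 := fK 0 isT; have K_gt0 : 0 < K by apply: leq_ltn_trans f0.
have [T lt_T TE] := IHN (f \o S) (fun i => fK i.+1).
exists (T * K + f 0) => [|[_|i]].
- rewrite expnSr; apply: (@leq_trans (T * K + K)); first by rewrite ltn_add2l.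
  by rewrite -mulSnr leq_mul2r lt_T orbT.
- by rewrite /digit divn1 modnMDl modn_small.
rewrite ltnS => lt_i; rewrite -[f i.+1]/((f \o S) i) -TE // /digit expnS divnMA.
by rewrite divnMDl // (divn_small f0) addn0.
Qed.

(** * The decision function *)

(** The length of the prefixes that are considered: a word of letters is shorter
than the code of any list of words to which it belongs. *)
Definition code_depth (n : nat) : nat := n + 3.
Definition code_states (n : nat) : nat := 2 ^ (2 * code_depth n + 1).

(** The automaton [T] has a colouring that 0 preserves, it identifies every word of
length [L] with its images, and it gives different colours to 1/2, whose word
has number 3, and to some other dyadic fraction.  The numbers [2 ^ L + r] with
[r < 2 ^ L] are those of the words of length [L], and the numbers
[2 ^ i * (2 * j + 1)] with [0 < j] are those of the words in which a 1 occurs. *)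
Definition separates (n T : nat) : bool :=
  let L := code_depth n in let K := code_states n in
  [&& all (fun q => colour K T (delta K T q 0) == colour K T q) (iota 0 K),
      all (fun c => all (fun r => run K T (2 ^ L + r) == run K T (word_actn c (2 ^ L + r)))
            (iota 0 (2 ^ L))) (CodeSeq.decode n) &
      has (fun i => has (fun j => (0 < j) &&
            ~~ (colour K T (run K T (2 ^ i * (2 * j + 1))) == colour K T (run K T 3)))
        (iota 0 (4 * K))) (iota 0 (4 * K))].

Definition decide (n : nat) : nat :=
  ~~ has (separates n) (iota 0 (code_states n ^ (3 * code_states n))).

Lemma rcv_digit n A B C : rcv n A -> rcv n B -> rcv n C ->
  rcv n (fun v => digit (A v) (B v) (C v)).
Proof. by apply: rcv_fun3; rewrite /digit; rcv. Qed.

Lemma rcv_delta n A B C D : rcv n A -> rcv n B -> rcv n C -> rcv n D ->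
  rcv n (fun v => delta (A v) (B v) (C v) (D v)).
Proof. by apply: rcv_fun4; rewrite /delta; apply: rcv_digit; rcv. Qed.

Lemma rcv_colour n A B C : rcv n A -> rcv n B -> rcv n C ->
  rcv n (fun v => colour (A v) (B v) (C v)).
Proof. by apply: rcv_fun3; rewrite /colour; apply: rcv_digit; rcv. Qed.

Lemma rcv_run n A B C : rcv n A -> rcv n B -> rcv n C ->
  rcv n (fun v => run (A v) (B v) (C v)).
Proof.
apply: rcv_fun3; rewrite /run; apply: rcv_iteri; rcv.
by apply: rcv_delta; rcv.
Qed.

Lemma rcv_x0_actn n A B : rcv n A -> rcv n B -> rcv n (fun v => x0_actn (A v) (B v)).
Proof. by apply: rcv_fun2; rewrite /x0_actn; rcv. Qed.

Lemma rcv_letter_actn n A B : rcv n A -> rcv n B -> rcv n (fun v => letter_actn (A v) (B v)).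
Proof. by apply: rcv_fun2; rewrite /letter_actn; rcv; apply: rcv_x0_actn; rcv. Qed.

Lemma rcv_word_actn n A B : rcv n A -> rcv n B -> rcv n (fun v => word_actn (A v) (B v)).
Proof.
apply: rcv_fun2; rewrite /word_actn.
apply: (rcv_foldl_decode (H := fun m l _ => letter_actn l m)); rcv.
by apply: rcv_letter_actn; rcv.
Qed.

Lemma rcv_states n A : rcv n A -> rcv n (fun v => code_states (A v)).
Proof. by apply: rcv_fun1; rewrite /code_states /code_depth; rcv. Qed.

Ltac rcv_named ::=
  lazymatch goal with
  | |- rcv _ (fun v => delta _ _ _ _) => apply: rcv_delta
  | |- rcv _ (fun v => colour _ _ _) => apply: rcv_colour
  | |- rcv _ (fun v => run _ _ _) => apply: rcv_run
  | |- rcv _ (fun v => word_actn _ _) => apply: rcv_word_actn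
  | |- rcv _ (fun v => code_states _) => apply: rcv_states
  end.

Lemma rcv_separates n A B : rcv n A -> rcv n B -> rcvb n (fun v => separates (A v) (B v)).
Proof.
apply: (@rcv_fun2 _ (fun a b => separates a b)).
rewrite /separates /code_depth; rcv.
apply: (rcv_all_decode
  (P := fun c v => all (fun r =>
      run (code_states (nth 0 v 0)) (nth 0 v 1) (2 ^ (nth 0 v 0 + 3) + r) ==
      run (code_states (nth 0 v 0)) (nth 0 v 1)
        (word_actn c (2 ^ (nth 0 v 0 + 3) + r))) (iota 0 (2 ^ (nth 0 v 0 + 3))))); rcv.
Qed.

Lemma recursive_decide : recursive (fun v : 1.-tuple nat => decide (nth 0 v 0)).
Proof.
apply: (@rcv_fun1 1 decide (nth 0 ^~ 0)); last by rcv.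
rewrite /decide; rcv; apply: rcv_separates; rcv.
Qed.

(** * Binary words as dyadic numbers *)

Definition pt (R : realType) (p : seq bool) : R :=
  foldr (fun (a : bool) (x : R) => (a%:R + x) / 2)%R 0%R p.

Arguments pt : simpl never.

Section Points.
Variable R : realType.
Local Open Scope ring_scope.
Implicit Types p q s : seq bool.

Lemma pt_cons (a : bool) p : pt R (a :: p) = (a%:R + pt R p) / 2.
Proof. by []. Qed.

Lemma pt_bounds p : 0 <= pt R p < 1.
Proof. by elim: p => [|a p]; rewrite ?pt_cons; [rewrite /pt /=; lra|case: a => /=; lra]. Qed.

Lemma pt_gt0 p : (0 < pt R p) = (true \in p).
Proof.
elim: p => [|a p IHp]; first by rewrite /pt /= ltxx.
rewrite in_cons -IHp pt_cons; have := pt_bounds p.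
by case: a => /= h; [apply/idP; lra | rewrite add0r pmulr_lgt0 ?invr_gt0].
Qed.

Lemma pt_cat p q s : pt R q = pt R s -> pt R (p ++ q) = pt R (p ++ s).
Proof. by move=> E; elim: p => //= a p; rewrite !pt_cons => ->. Qed.

Lemma pt_pad p k : pt R (p ++ nseq k false) = pt R p.
Proof.
rewrite -[in RHS](cats0 p); apply: pt_cat.
by elim: k => //= k; rewrite pt_cons => ->; rewrite /pt /=; lra.
Qed.

Lemma pt_dyadic p : dyadic (pt R p).
Proof.
elim: p => [|a p IHp]; first exact: dyadic0.
rewrite pt_cons mulrC -[2^-1]exprN1; apply: dyadic_scale; apply: dyadicD => //.
by exists a%:Z, 0%N; rewrite expr0 divr1.
Qed.

Lemma pt_dyadic_fractions p : true \in p -> dyadic_fractions R (pt R p).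
Proof.
by rewrite -pt_gt0 => p0; split; [exact: pt_dyadic | rewrite p0; have /andP[] := pt_bounds p].
Qed.

(** The first bit tells whether the number lies in the lower or the upper half. *)
Lemma nat_pt n m : (m < 2 ^ n)%N -> exists p, pt R p = m%:R / 2 ^+ n.
Proof.
elim: n m => [|n IHn] m lt_m.
  by exists [::]; rewrite (_ : m = 0)%N ?mul0r //; lia.
have nz : (2 : R) ^+ n != 0 by rewrite expf_neq0.
have [lt_mn|le_nm] := ltnP m (2 ^ n).
  have [p pE] := IHn _ lt_mn; exists (false :: p).
  by rewrite pt_cons pE exprS /=; field.
have [|p pE] := IHn (m - 2 ^ n)%N; first by rewrite expnS in lt_m; lia.
exists (true :: p); rewrite pt_cons pE natrB // natrX exprS /=; by field.
Qed.

Lemma dyadic_fractionsP x :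
  dyadic_fractions R x -> exists2 p, true \in p & pt R p = x.
Proof.
case=> -[m [n ->]] /andP[x0 x1].
have n0 : (0 : R) < 2 ^+ n by rewrite exprn_gt0.
move: x0 x1; rewrite ltr_pdivlMr // mul0r ltr_pdivrMr // mul1r => m0 m1.
case: m m0 m1 => [m|m]; last by rewrite NegzE mulrNz oppr_gt0 ltrz0.
rewrite -pmulrn => m0; rewrite -natrX ltr_nat => m1.
have [p pE] := nat_pt m1.
by exists p; rewrite -?pt_gt0 pE ?divr_gt0 ?natrX.
Qed.

Lemma pt_inj p q : size p = size q -> pt R p = pt R q -> p = q.
Proof.
elim: p q => [|a p IHp] [|b q] //= [sz_pq]; rewrite !pt_cons => E.
have hp := pt_bounds p; have hq := pt_bounds q.
have ab : a = b by move: E; case: (a); case: (b) => //=; lra.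
by rewrite ab (IHp q) //; move: E; rewrite ab; lra.
Qed.

(** Equality of dyadic numbers is equality of expansions up to final zeros. *)
Lemma pt_eq p q : pt R p = pt R q ->
  p ++ nseq (size q) false = q ++ nseq (size p) false.
Proof.
move=> E; apply: pt_inj; last by rewrite !pt_pad.
by rewrite !size_cat !size_nseq addnC.
Qed.

Lemma x0_pt p : x0 R (pt R p) = pt R (x0_act false p).
Proof.
have pt0 : pt R [::] = 0 by [].
case: p => [|a [|b p]]; rewrite /= /x0_fun; last have := pt_bounds p.
- by rewrite pt0; do ?[case: ifP]; lra.
- by case: a; rewrite !pt_cons pt0 /=; do ?[case: ifP]; lra.
- by case: a; case: b; rewrite !pt_cons /=; do ?[case: ifP]; lra.
Qed.

Lemma x1_pt p : x1 R (pt R p) = pt R (letter_act (true, false) p).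
Proof.
have pt0 : pt R [::] = 0 by [].
case: p => [|a [|b [|c p]]]; rewrite /= /x1_fun; last have := pt_bounds p.
- by rewrite /letter_act /= pt0; do ?[case: ifP]; lra.
- by case: a; rewrite /letter_act /= !pt_cons pt0 /=; do ?[case: ifP]; lra.
- by case: a; case: b; rewrite /letter_act /= !pt_cons pt0 /=; do ?[case: ifP]; lra.
by case: a; case: b; case: c; rewrite /letter_act /= !pt_cons /=; do ?[case: ifP]; lra.
Qed.

(** For an inverse letter: the generator takes the claimed image back to the given
point. *)
Lemma letter_pt l p : (2 < size p)%N -> letter_val R l (pt R p) = pt R (letter_act l p).
Proof.
case: l => -[] [] sz_p; rewrite /letter_val /=.
- have pE : letter_act (true, false) (letter_act (true, true) p) = p.
    by case: p sz_p => [|[] p] //= sz_p; congr cons; exact: (@x0_actK true).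
  by rewrite -{1}pE -x1_pt; exact: thompson_invK.
- by rewrite -x1_pt.
- have pE : x0_act false (x0_act true p) = p by apply: (@x0_actK true); rewrite ltnW.
  by rewrite -{1}pE -x0_pt; exact: thompson_invK.
- by rewrite -x0_pt.
Qed.

Lemma word_pt w p : (size w + 2 < size p)%N ->
  word_val R w (pt R p) = pt R (word_act w p).
Proof.
rewrite /word_val; elim: w p => [|l w IHw] p /= sz_p; first by rewrite big_nil.
rewrite big_cons /= letter_pt; last by lia.
by rewrite IHw //; have /andP[h _] := size_letter_act l (p := p) ltac:(lia); lia.
Qed.

End Points.

(** * Invariant colourings by automata *)

Section Invariants.
Variables (R : realType) (ws : seq word) (L : nat).
Hypothesis size_ws : forall w, w \in ws -> size w + 2 < L.
Local Notation H := (generated_subgroup (words_val R ws)).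
Implicit Types (p q s : seq bool) (h : thompsonF R).

(** Induction on a generated subgroup. *)
Lemma generated_sub (A : set (thompsonF R)) : is_subgroup A ->
  (forall w, w \in ws -> A (word_val R w)) -> forall h, H h -> A h.
Proof.
move=> subA wsA h; apply; split => // _ [w w_in <-]; exact: wsA.
Qed.

Lemma generated_word w : w \in ws -> H (word_val R w).
Proof. by move=> w_in A [_]; apply; exists w. Qed.

Lemma generated_one : H 1%g.
Proof. by move=> A [[]]. Qed.

Lemma generated_mul h1 h2 : H h1 -> H h2 -> H (h1 * h2)%g.
Proof. by move=> h1H h2H A AP; case: (AP) => -[_ + _] _; apply; [exact: h1H | exact: h2H]. Qed.

Lemma generated_inv h : H h -> H h^-1%g.
Proof. by move=> hH A AP; case: (AP) => -[_ _ +] _; apply; exact: hH. Qed.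

Lemma thompson_pt h p : true \in p -> exists2 q, true \in q & h (pt R p) = pt R q.
Proof.
move=> /(pt_dyadic_fractions R)/(thompson_dyadic (thompsonF_is_thompson h)).
by move=> /dyadic_fractionsP[q q_in <-]; exists q.
Qed.

Section Sound.
Variables (d : nat -> bool -> nat) (col : nat -> nat).
Let read p := foldl d 1 p.
Hypothesis col0 : forall p, col (d (read p) false) = col (read p).
Hypothesis read_ws :
  forall w p, w \in ws -> size p = L -> read p = read (word_act w p).

Let col_pad p k : col (read (p ++ nseq k false)) = col (read p).
Proof.
elim: k => [|k <-]; first by rewrite cats0.
by rewrite -addn1 nseqD catA /read foldl_cat /= col0.
Qed.

Let col_pt p q : pt R p = pt R q -> col (read p) = col (read q).
Proof. by move=> /pt_eq E; rewrite -(col_pad p (size q)) E col_pad. Qed.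

Let read_cat p q s : read p = read q -> read (p ++ s) = read (q ++ s).
Proof. by rewrite /read !foldl_cat => ->. Qed.

(** The elements that preserve colours form a subgroup.  A generator belongs to it:
after padding with zeros, which changes neither the point nor the colour, it
replaces a prefix of length [L] by one that leads to the same state. *)
Lemma colour_invariant h p q :
  H h -> true \in p -> h (pt R p) = pt R q -> col (read p) = col (read q).
Proof.
move=> Hh; move: h Hh p q.
apply: (@generated_sub (fun h => forall p q, true \in p ->
   h (pt R p) = pt R q -> col (read p) = col (read q))).
  split=> [p q _ /col_pt //|a b aP bP p q p_in|a aP p q p_in E].
    have [r r_in rE] := thompson_pt a p_in.
    by rewrite /= rE => E; rewrite -(bP _ _ r_in E); exact: aP.
  have aE : a (pt R q) = pt R p by rewrite -E; exact: thompson_invKV.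
  apply/esym/aP => //; have [r r_in rE] := thompson_pt a^-1%g p_in.
  by move: r_in; rewrite -!(pt_gt0 R) -rE E.
move=> w w_in p q p_in.
rewrite -(pt_pad R p L) -(col_pad p L).
set p' := _ ++ _; rewrite -(cat_take_drop L p').
set p1 := take L p'; have sz : size p1 = L.
  by rewrite size_takel // size_cat size_nseq leq_addl.
have sz_w : size w + 2 < size p1 by rewrite sz size_ws.
rewrite word_pt; last by rewrite size_cat ltn_addr.
by rewrite word_act_cat // => /col_pt <-; congr col; apply/read_cat/read_ws.
Qed.

Lemma separated_not_transitive p :
    true \in p -> col (read p) <> col (read [:: true]) ->
  ~ acts_transitively H (dyadic_fractions R).
Proof.
move=> p_in neq; have half_in : true \in [:: true] by [].
move=> /(_ _ _ (pt_dyadic_fractions R p_in) (pt_dyadic_fractions R half_in))[h Hh].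
by move=> /(colour_invariant Hh p_in).
Qed.

End Sound.

Section Complete.
Local Notation M := (2 * L).
Local Notation K := (2 ^ M.+1).
Hypothesis L_gt0 : 0 < L.

(** Some element of the subgroup maps the interval of [p] affinely onto that of
[q].  Stated with all continuations [s], the relation is a right
congruence by construction. *)
Let rel p q : Prop := exists2 h, H h & forall s, h (pt R (p ++ s)) = pt R (q ++ s).

Let rel_refl p : rel p p.
Proof. by exists 1%g; first exact: generated_one. Qed.

Let rel_sym p q : rel p q -> rel q p.
Proof.
case=> h Hh hE; exists h^-1%g; first exact: generated_inv.
by move=> s; rewrite -hE; exact: thompson_invK.
Qed.

Let rel_trans q p r : rel p q -> rel q r -> rel p r.
Proof.
case=> h Hh hE [k Hk kE]; exists (h * k)%g; first exact: generated_mul.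
by move=> s; rewrite -kE -hE.
Qed.

Let rel_cat p q s : rel p q -> rel (p ++ s) (q ++ s).
Proof. by case=> h Hh hE; exists h => // t; rewrite -!catA. Qed.

Let rel_word_act w p : w \in ws -> size p = L -> rel p (word_act w p).
Proof.
move=> w_in sz_p; exists (word_val R w); first exact: generated_word.
have sz_w : size w + 2 < size p by rewrite sz_p size_ws.
by move=> s; rewrite word_pt ?word_act_cat // size_cat ltn_addr.
Qed.

Let coded p : pred nat := fun m => `[< exists2 q, rel p q & bcode q = m >].

Let coded_ex p : exists m, coded p m.
Proof. by exists (bcode p); apply/asboolP; exists p. Qed.

(** The least number of a word of the class of [p]; it is the number of a shortest
word of the class, by [bcode_lt]. *)
Let rep p := ex_minn (coded_ex p).

Let rep_le p q : rel p q -> rep p <= bcode q.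
Proof.
move=> pq; rewrite /rep; case: ex_minnP => m _; apply.
by apply/asboolP; exists q.
Qed.

Let rep_ex p : exists2 q, rel p q & bcode q = rep p.
Proof. by rewrite /rep; case: ex_minnP => m /asboolP. Qed.

Let rep_gt0 p : 0 < rep p.
Proof. by have [q _ <-] := rep_ex p; exact: bcode_gt0. Qed.

Let rep_eq p q : rel p q -> rep p = rep q.
Proof.
suff le p' q' : rel p' q' -> rep p' <= rep q'.
  by move=> pq; apply/eqP; rewrite eqn_leq !le //; exact: rel_sym.
move=> pq; have [r qr <-] := rep_ex q'.
by apply: rep_le; apply: rel_trans pq qr.
Qed.

Let decode_ex : exists uncode, forall m, 0 < m -> bcode (uncode m) = m.
Proof.
have /choice[v vP] : forall m, exists p, 0 < m -> bcode p = m.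
  by case=> [|m]; [exists [::] | have [p] := @bcode_surj m.+1 isT; exists p].
by exists v.
Qed.

Let uncode := proj1_sig (cid decode_ex).
Let uncodeK m : 0 < m -> bcode (uncode m) = m.
Proof. exact: (proj2_sig (cid decode_ex)). Qed.

Let rel_rep p : rel p (uncode (rep p)).
Proof.
have [q pq qE] := rep_ex p.
by rewrite (_ : uncode _ = q) //; apply: bcode_inj; rewrite uncodeK.
Qed.

(** States are numbers of words.  Those of words shorter than [M] follow the
congruence.  The others are the sink 0 and the numbers of words of length at
least [M]: a 1 leads them to the sink, a 0 changes nothing. *)
Let d m (a : bool) :=
  if 0 < m < 2 ^ M then rep (uncode m ++ [:: a]) else if a then 0 else m.

Let read p := foldl d 1 p.

Let read_rcons p a : read p = rep p -> rep p < 2 ^ M ->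
  read (rcons p a) = rep (rcons p a).
Proof.
rewrite /read foldl_rcons => -> lt_p; rewrite /d rep_gt0 lt_p /= -cats1.
by apply/rep_eq/rel_cat/rel_sym.
Qed.

Let rep_nil : rep [::] = 1.
Proof. by apply/eqP; rewrite eqn_leq rep_gt0 (rep_le (rel_refl [::])). Qed.

Let rep_lt p k : size p < k -> rep p < 2 ^ k.
Proof. by rewrite -bcode_lt => h; apply: leq_ltn_trans (rep_le (rel_refl p)) h. Qed.

(** Along a word of length at most [M], every transition is taken from a state less
than [2 ^ M], hence follows the congruence. *)
Let read_short p : size p <= M -> read p = rep p.
Proof.
elim/last_ind: p => [|p a IHp]; first by rewrite rep_nil.
by rewrite size_rcons => lt_p; rewrite read_rcons ?IHp ?rep_lt // ltnW.
Qed.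

Let d_lt m a : m < K -> d m a < K.
Proof.
rewrite /d => lt_m; case: ifP => [/andP[m0 mM]|_]; last by case: a => //; rewrite expn_gt0.
by apply: rep_lt; rewrite size_cat addn1 ltnS -bcode_lt uncodeK.
Qed.

Let read_word_act w p : w \in ws -> size p = L -> read p = read (word_act w p).
Proof.
move=> w_in sz_p; have := size_ws w_in => sz_w.
rewrite !read_short; first by apply/rep_eq/rel_word_act.
  apply: leq_trans (size_word_act _) _; rewrite sz_p // mul2n -addnn leq_add2l.
  by apply: leq_trans (leq_addr 2 _) (ltnW sz_w).
by rewrite sz_p mul2n -addnn leq_addr.
Qed.

Let read_half : read [:: true] = rep [:: true].
Proof. by apply: read_short => /=; lia. Qed.

Let to_half p : Prop := exists2 h, H h & h (pt R p) = pt R [:: true].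

Let to_half_rel p q : rel p q -> to_half q -> to_half p.
Proof.
case=> h Hh hE [k Hk kE]; exists (h * k)%g; first exact: generated_mul.
by rewrite -kE; have := hE [::]; rewrite !cats0 => <-.
Qed.

Lemma not_transitive_separated :
  ~ acts_transitively H (dyadic_fractions R) ->
  exists (d : nat -> bool -> nat) (col : nat -> nat),
    [/\ forall m a, m < K -> d m a < K, forall m, col m <= 1,
        forall m, col (d m false) = col m,
        forall w p, w \in ws -> size p = L ->
          foldl d 1 p = foldl d 1 (word_act w p) &
        exists p, [/\ true \in p, size p <= M.+1 &
          col (foldl d 1 p) <> col (foldl d 1 [:: true])]].
Proof.
move=> ntrans; exists d.
(* Either a word of length [M] is least in its class, or every one of them is
   equivalent to a shorter word. *)
have [[p sz_p le_p]|short] := pselect (exists2 p, size p = M & 2 ^ M <= rep p).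
  exists (fun m => m == 0); split=> [//|m|m||]; first by case: eqP.
  - rewrite /d; case: ifP => // /andP[m0 _]; move: m0.
    by have := rep_gt0 (uncode m ++ [:: false]); case: (rep _) => //; case: m.
  - exact: read_word_act.
  exists (rcons p true); split; first by rewrite mem_rcons in_cons.
    by rewrite size_rcons sz_p.
  rewrite -/(read _) -/(read _) read_half /read foldl_rcons -/(read _).
  rewrite read_short ?sz_p // /d (ltnNge (rep p)) le_p andbF.
  by have := rep_gt0 [:: true]; case: (rep _).
(* No state of length [M] is ever reached: the automaton computes classes. *)
have readE p : read p = rep p /\ rep p < 2 ^ M.
  elim/last_ind: p => [|p a [IHp lt_p]].
    by rewrite rep_lt ?rep_nil // muln_gt0.
  split; first exact: read_rcons.
  rewrite -cats1 (rep_eq (rel_cat [:: a] (rel_rep p))).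
  have : size (uncode (rep p)) < M by rewrite -bcode_lt uncodeK.
  rewrite leq_eqVlt => /predU1P[sz|lt]; last by apply: rep_lt; rewrite size_cat addn1.
  rewrite ltnNge; apply/negP => le; apply: short.
  by exists (uncode (rep p) ++ [:: a]) => //; rewrite size_cat addn1.
(* The sink is never reached; its colour only has to be preserved by 0. *)
pose col m : nat := (0 < m) && `[< to_half (uncode m) >].
have colE p : col (rep p) = `[< to_half p >].
  rewrite /col rep_gt0 /=; congr nat_of_bool; apply: asbool_equiv_eq.
  by split; apply: to_half_rel; [exact: rel_rep | exact/rel_sym/rel_rep].
exists col; split=> [//|m|m||]; first exact: leq_b1.
- rewrite /d; case: ifP => // /andP[m0 _]; rewrite colE /col m0 /=.
  by rewrite /to_half (pt_pad R (uncode m) 1).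
- exact: read_word_act.
(* If all dyadic fractions were in the orbit of 1/2, there would be one orbit. *)
have [p p_in pP] : exists2 p, true \in p & ~ to_half p.
  apply: contrapT => nex; apply: ntrans => x y xD yD.
  have hv z : dyadic_fractions R z -> exists2 h, H h & h z = pt R [:: true].
    move=> /dyadic_fractionsP[p p_in <-]; apply: contrapT => nh.
    by apply: nex; exists p.
  have [h Hh hx] := hv _ xD; have [k Hk ky] := hv _ yD.
  exists (h * k^-1)%g; first by apply: generated_mul => //; exact: generated_inv.
  by rewrite /= hx -ky; exact: thompson_invK.
(* The least word of the class of [p] is short enough for the bounded search. *)
exists (uncode (rep p)); split.
- have [h _ /(_ [::])] := rel_rep p; rewrite !cats0 => hE.
  by have [q] := thompson_pt h p_in; rewrite -!(pt_gt0 R) hE => q0 ->.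
- by apply/ltnW/ltnW; rewrite ltnS -bcode_lt uncodeK //; have [] := readE p.
rewrite -/(read _) -/(read _) read_half (readE _).1 -(rep_eq (rel_rep p)) !colE.
rewrite (asboolF pP) (@asboolT (to_half [:: true])) //.
by exists 1%g; first exact: generated_one.
Qed.

End Complete.
End Invariants.

(** * Separating automata and transitivity *)

Lemma size_depth ws w : w \in ws -> size w + 2 < code_depth (words_code ws).
Proof.
move=> w_in; rewrite /code_depth (addnA _ 1 2) ltn_add2r addn1 ltnS; apply: ltnW.
have : word_code w < words_code ws.
  by apply: (allP (CodeSeq.ltn_code _)); rewrite map_f.
apply: leq_ltn_trans; rewrite -(size_map letter_code); exact: size_code.
Qed.

Lemma first_true (p : seq bool) : true \in p ->
  exists i s, p = nseq i false ++ true :: s.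
Proof.
elim: p => //= -[] p IHp; first by exists 0, p.
by rewrite in_cons => /IHp[i [s ->]]; exists i.+1, s.
Qed.

Lemma bcode_first_true i s :
  bcode (nseq i false ++ true :: s) = 2 ^ i * (2 * bcode s + 1).
Proof. by elim: i => [|i IHi]; rewrite /= ?IHi ?expnS ?expn0; lia. Qed.

Lemma separates_not_transitive (R : realType) ws T :
  separates (words_code ws) T ->
  ~ acts_transitively (generated_subgroup (words_val R ws)) (dyadic_fractions R).
Proof.
have wsL w : w \in ws -> size w + 2 < code_depth (words_code ws) by exact: size_depth.
rewrite /separates; set L := code_depth _ in wsL *; set K := code_states _.
have K_gt1 : 1 < K by rewrite -{1}(expn0 2) ltn_exp2l // addn1.
have K_gt0 := ltnW K_gt1.
case/and3P => /allP col0 /allP read_ws /hasP[i _ /hasP[j _ /andP[j_gt0 /eqP neq]]].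
pose d q (a : bool) := delta K T q a.
have readE p : run K T (bcode p) = foldl d 1 p by exact: runE.
have [s sE] := bcode_surj j_gt0.
refine (@separated_not_transitive R ws L wsL d (colour K T) _ _
  (nseq i false ++ true :: s) _ _).
- move=> p; apply/eqP/col0; rewrite mem_iota /=.
  by elim/last_ind: p => // p a _; rewrite foldl_rcons ltn_pmod.
- move=> w p w_in sz_p.
  have : word_code w \in CodeSeq.decode (words_code ws).
    by rewrite CodeSeq.codeK map_f.
  have /andP[lb ub] := bcode_bounds p; rewrite sz_p in lb ub.
  move=> /read_ws/allP/(_ (bcode p - 2 ^ L)).
  rewrite mem_iota subnKC // word_actnE ?sz_p ?wsL // !readE => h.
  by apply/eqP/h; rewrite ltn_subLR // addnn -mul2n -expnS.
- by rewrite mem_cat mem_head orbT.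
- by rewrite -!readE bcode_first_true sE.
Qed.

(** The automaton of [not_transitive_separated] fits in a table in base [K], because
its transitions do not leave the states below [K]. *)
Lemma not_transitive_separates (R : realType) ws :
  ~ acts_transitively (generated_subgroup (words_val R ws)) (dyadic_fractions R) ->
  exists2 T, T < code_states (words_code ws) ^ (3 * code_states (words_code ws)) &
    separates (words_code ws) T.
Proof.
have wsL w : w \in ws -> size w + 2 < code_depth (words_code ws) by exact: size_depth.
have L_gt0 : 0 < code_depth (words_code ws) by rewrite /code_depth addn3.
case/(not_transitive_separated wsL L_gt0) => d [col [d_lt col_le col0 read_ws]].
rewrite /separates /code_states; set L := code_depth _ in wsL L_gt0 d_lt read_ws *.
rewrite addn1; set M := 2 * L; set K := 2 ^ M.+1.
have K_gt1 : 1 < K by rewrite -{1}(expn0 2) ltn_exp2l.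
move=> [p [p_in sz_p neq]].
pose f i := if i %% 3 == 2 then col (i %/ 3) else d (i %/ 3) (i %% 3 == 1).
have [|T lt_T TE] := @digits_ex K (3 * K) f.
  move=> i lt_i; rewrite /f; case: ifP => _; first exact: leq_ltn_trans (col_le _) K_gt1.
  by apply: d_lt; rewrite ltn_divLR // mulnC.
have dE q (a : bool) : q < K -> delta K T q a = d q a.
  move=> lt_q; rewrite /delta TE; last by case: a; lia.
  by rewrite /f [3 * q]mulnC modnMDl divnMDl //; case: a => /=; rewrite addn0.
have colE q : q < K -> colour K T q = col q.
  move=> lt_q; rewrite /colour TE; last by lia.
  by rewrite /f [3 * q]mulnC modnMDl divnMDl //= addn0.
have readE s : run K T (bcode s) = foldl d 1 s /\ foldl d 1 s < K.
  rewrite runE; elim/last_ind: s => [//|s a [IH lt]].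
  by rewrite !foldl_rcons IH dE //; split=> //; exact: d_lt.
exists T => //; apply/and3P; split.
- apply/allP => q; rewrite mem_iota => /= lt_q; apply/eqP.
  by rewrite (dE _ false) // !colE ?col0 //; exact: d_lt.
- rewrite CodeSeq.codeK; apply/allP => _ /mapP[w w_in ->]; apply/allP => r.
  rewrite mem_iota => /= lt_r; have [s sE] : exists s, bcode s = 2 ^ L + r.
    by apply: bcode_surj; rewrite addn_gt0 expn_gt0.
  have sz_s : size s = L.
    have lt_s : size s < L.+1.
      by rewrite -bcode_lt sE expnS mul2n -addnn ltn_add2l.
    have : ~~ (size s < L) by rewrite -bcode_lt sE -leqNgt leq_addr.
    by rewrite -leqNgt => le_s; apply/eqP; rewrite eqn_leq -ltnS lt_s.
  by rewrite -sE word_actnE ?sz_s ?wsL // !(readE _).1 (read_ws w).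
have [i [s pE]] := first_true p_in.
have : bcode p < 2 * K by rewrite -expnS bcode_lt.
rewrite pE bcode_first_true => lt_p; have s_gt0 := bcode_gt0 s.
have i_lt := ltn_expl i (isT : 1 < 2).
apply/hasP; exists i; first by rewrite mem_iota /=; nia.
apply/hasP; exists (bcode s); first by rewrite mem_iota /=; nia.
rewrite s_gt0 -bcode_first_true -pE -[3]/(bcode [:: true]) !(readE _).1.
by rewrite !colE ?(readE _).2 //; apply/eqP.
Qed.

Theorem mainTheorem2 (R : realType) :
  algorithmically_decidable words_code
    (fun ws : seq word =>
       acts_transitively (generated_subgroup (words_val R ws))
         (dyadic_fractions R)).
Proof.
exists (fun v => decide (nth 0 v 0)); first exact: recursive_decide.
move=> ws /=; rewrite /decide; split=> [trans|/not_transitive_separates[T lt_T sep]].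
  by case: hasP => // -[T _ /(@separates_not_transitive R)].
by case: hasP => // -[]; exists T => //; rewrite mem_iota.
Qed.
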